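(* Let $i,j$ be positive integers. Then $(i,j,1,1)\in\mathcal{A}_{\mathbb{Z}_2}$ if and only if $(i,j)\equiv(1,1)\pmod 2$, or $(i,j)\equiv(1,2)\pmod 3$, or $(i,j)\equiv(2,1)\pmod 3$ (congruences being taken componentwise).
   Context: All rings are associative and unital and all homomorphisms are unital. $\mathbb{Z}_2$ is the field with two elements. For a commutative ring $A$ and positive integers $i,j$, $R(A;i,j,1,1)$ is the quotient of the free (noncommutative) $A$-algebra $A\langle x,y\rangle$ by the two-sided ideal generated by $x^iy+yx^j-1$ and $y^2$. For a field $k$, $(i,j,1,1)\in\mathcal{A}_k$ means that there is a non-trivial homomorphism $R(k;i,j,1,1)\to M_2(k)$; equivalently, there exist $2\times2$ matrices $x,y\in M_2(k)$ with $x^iy+yx^j=1$ and $y^2=0$. *)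

(* Defs.v *)
From HB Require Import structures.
From mathcomp Require Import all_boot all_algebra.
From mathcomp.classical Require Import boolp.
From mathcomp.multinomials Require Import monalg.

Set Implicit Arguments.
Unset Strict Implicit.
Unset Printing Implicit Defensive.

Import GRing.Theory.
Local Open Scope ring_scope.
Local Open Scope quotient_scope.

(* The library's [{ideal_quot I}] only covers proper ideals of commutative
   rings.  Here the ring is arbitrary and the ideal may be improper, so the
   quotient is a [pzRingType]: it may be the zero ring. *)
Section TwoSidedIdeal.
Variables (T : nzRingType) (G : T -> Prop).

Inductive in_ideal : T -> Prop :=
| in_ideal_gen a of G a : in_ideal a
| in_ideal0 : in_ideal 0
| in_idealD a b of in_ideal a & in_ideal b : in_ideal (a + b)
| in_idealMl c a of in_ideal a : in_ideal (c * a)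
| in_idealMr c a of in_ideal a : in_ideal (a * c).

Definition ideal (a : T) : bool := `[< in_ideal a >].

Lemma idealP a : reflect (in_ideal a) (a \in ideal).
Proof. exact: asboolP. Qed.

Lemma ideal_zmod_closed : zmod_closed ideal.
Proof.
split=> [|a b /idealP Ia /idealP Ib]; apply/idealP; first exact: in_ideal0.
by rewrite -mulN1r; apply: in_idealD => //; apply: in_idealMl.
Qed.

HB.instance Definition _ := GRing.isZmodClosed.Build T ideal ideal_zmod_closed.

Definition ring_quot := Quotient.quot (GRing.ZmodClosed.clone T ideal _).

HB.instance Definition _ := GRing.Zmodule.on ring_quot.
HB.instance Definition _ := EqQuotient.on ring_quot.

Definition ring_quot_one : ring_quot := \pi_ring_quot 1.
Definition ring_quot_mul := lift_op2 ring_quot *%R.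

Lemma pi_ring_quotE a b :
  (\pi_ring_quot a = \pi_ring_quot b) <-> in_ideal (a - b).
Proof.
split=> [/eqP|/idealP Iab]; last apply/eqP.
  by rewrite -Quotient.idealrBE => /idealP.
by rewrite -Quotient.idealrBE.
Qed.

Lemma pi_ring_quotD a b : \pi_ring_quot (a + b) = \pi a + \pi b.
Proof. exact: Quotient.pi_add. Qed.

Lemma pi_ring_quotM a b :
  \pi_ring_quot (a * b) = ring_quot_mul (\pi a) (\pi b).
Proof.
unlock ring_quot_mul; apply/pi_ring_quotE.
set a' := repr _; set b' := repr _.
have Ia : in_ideal (a - a') by apply/pi_ring_quotE; rewrite reprK.
have Ib : in_ideal (b - b') by apply/pi_ring_quotE; rewrite reprK.
have -> : a * b - a' * b' = (a - a') * b + a' * (b - b').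
  by rewrite mulrBl mulrBr addrA subrK.
by apply: in_idealD; [apply: in_idealMr | apply: in_idealMl].
Qed.

Lemma ring_quot_mulA : associative ring_quot_mul.
Proof.
elim/quotW=> a; elim/quotW=> b; elim/quotW=> c.
by rewrite -!pi_ring_quotM mulrA.
Qed.

Lemma ring_quot_1mul : left_id ring_quot_one ring_quot_mul.
Proof. by elim/quotW=> a; rewrite -pi_ring_quotM mul1r. Qed.

Lemma ring_quot_mul1 : right_id ring_quot_one ring_quot_mul.
Proof. by elim/quotW=> a; rewrite -pi_ring_quotM mulr1. Qed.

Lemma ring_quot_mulDl : left_distributive ring_quot_mul +%R.
Proof.
elim/quotW=> a; elim/quotW=> b; elim/quotW=> c.
by rewrite -pi_ring_quotD -!pi_ring_quotM mulrDl pi_ring_quotD.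
Qed.

Lemma ring_quot_mulDr : right_distributive ring_quot_mul +%R.
Proof.
elim/quotW=> a; elim/quotW=> b; elim/quotW=> c.
by rewrite -pi_ring_quotD -!pi_ring_quotM mulrDr pi_ring_quotD.
Qed.

HB.instance Definition _ := GRing.Zmodule_isPzRing.Build ring_quot
  ring_quot_mulA ring_quot_1mul ring_quot_mul1 ring_quot_mulDl ring_quot_mulDr.

End TwoSidedIdeal.

(* [fmonom bool] is the free monoid on two letters, so its monoid algebra
   is the free algebra A<x, y>. *)
Definition free_alg2 (A : comNzRingType) := {malg A[fmonom bool]}.
HB.instance Definition _ (A : comNzRingType) := GRing.Lalgebra.on (free_alg2 A).

Definition genx (A : comNzRingType) : free_alg2 A := << fmu false >>.
Definition geny (A : comNzRingType) : free_alg2 A := << fmu true >>.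

Definition rels (A : comNzRingType) (i j : nat) (a : free_alg2 A) : Prop :=
  a = genx A ^+ i * geny A + geny A * genx A ^+ j - 1 \/ a = geny A ^+ 2.

(* The ring R(A; i, j, 1, 1). *)
Definition R11 (A : comNzRingType) (i j : nat) := ring_quot (@rels A i j).
HB.instance Definition _ (A : comNzRingType) (i j : nat) :=
  GRing.PzRing.on (R11 A i j).

(* (i, j, 1, 1) \in A_k *)
Definition in_calA11 (k : fieldType) (i j : nat) : Prop :=
  exists f : {rmorphism R11 k i j -> 'M[k]_2}, exists r, f r != 0.

(* Main.v *)
Require Import Defs.
From HB Require Import structures.
From mathcomp Require Import all_boot all_algebra.
From mathcomp.multinomials Require Import monalg.

Import GRing.Theory.

(** By the universal property of [R11] ([in_calA11P]) the question is for which
    exponents there are matrices [x], [y] over the field with two elements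
    such that [x ^+ i * y + y * x ^+ j = 1] and [y ^+ 2 = 0].

    Only if ([exponents_of_solution]).  By Cayley-Hamilton, [x ^+ 2] is one of
    [0], [1], [x], [x + 1].  The rest takes place in any nonzero ring of
    characteristic two and rests on two remarks.
    - Neither [x ^+ i] nor [x ^+ j] commutes with [y]: otherwise multiplying
      the equation by [y] on one side gives [y = 0]
      ([square0_not_comm]).
    - If [x * y + y * x = 1] then [x ^+ 2] commutes with [y], because the
      commutator with [y] is a derivation and the characteristic is two;
      so [x ^+ 2] is neither [x] nor [x + 1] ([anticomm_sqr_neq]).
    If [x ^+ 2 = 0], the first remark forces [i = j = 1]; if [x ^+ 2 = 1], it
    forces [i] and [j] to be odd.  If [x ^+ 2 = x], the equation reads
    [x * y + y * x = 1], against the second remark.  If [x ^+ 2 = x + 1], then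
    [x ^+ 3 = 1]; the first remark says that 3 divides neither [i] nor [j], and
    if they were congruent the equation would again be [x * y + y * x = 1].

    If ([solution_of_exponents]).  Take for [y] and [z] the two off-diagonal
    matrix units.  The swap [y + z] is an involution that solves the case of
    odd exponents, and [y + z + z * y] has order three and solves the two
    others. *)

Definition admissible (i j : nat) : Prop :=
  [\/ i = 1 %[mod 2] /\ j = 1 %[mod 2],
      i = 1 %[mod 3] /\ j = 2 %[mod 3] |
      i = 2 %[mod 3] /\ j = 1 %[mod 3]].

Section UniversalProperty.
Local Open Scope ring_scope.
Local Open Scope quotient_scope.

Lemma in_ideal_ker (T : nzRingType) (G : T -> Prop) (S : pzRingType)
    (phi : {rmorphism T -> S}) :
  (forall a, G a -> phi a = 0) -> forall a, in_ideal G a -> phi a = 0.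
Proof.
move=> phiG a; elim=> {a} [a /phiG // | | a b _ pa _ pb | c a _ pa | c a _ pa].
- exact: rmorph0.
- by rewrite rmorphD pa pb addr0.
- by rewrite rmorphM pa mulr0.
- by rewrite rmorphM pa mul0r.
Qed.

(** The induced morphism is computed on representatives; their choice does not
    matter because [phi] kills the whole ideal. *)
Lemma ring_quot_lift (T : nzRingType) (G : T -> Prop) (S : pzRingType)
    (phi : {rmorphism T -> S}) :
  (forall a, G a -> phi a = 0) ->
  exists f : {rmorphism ring_quot G -> S}, forall a, f (\pi a) = phi a.
Proof.
move=> phiG; pose p (a : T) : ring_quot G := \pi a.
pose f (q : ring_quot G) := phi (repr q).
have fp a : f (p a) = phi a.
  apply/eqP; rewrite -subr_eq0 -rmorphB; apply/eqP.
  by apply: (in_ideal_ker _ _ _ phi phiG); apply/pi_ring_quotE; rewrite reprK.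
have fB : zmod_morphism f.
  elim/quotW=> a; elim/quotW=> b; rewrite -/(p a) -/(p b).
  have -> : p a - p b = p (a - b).
    by apply/eqP; rewrite subr_eq -[_ + _]pi_ring_quotD subrK.
  by rewrite !fp rmorphB.
have fM : monoid_morphism f.
  split=> [|q r]; first by rewrite [LHS]fp rmorph1.
  elim/quotW: q => a; elim/quotW: r => b.
  by rewrite -[_ * _]pi_ring_quotM -!/(p _) !fp rmorphM.
pose fZ := GRing.isZmodMorphism.Build _ _ f fB.
pose fR := GRing.isMonoidMorphism.Build _ _ f fM.
pose F : {rmorphism ring_quot G -> S} := HB.pack f fZ fR.
by exists F.
Qed.

Definition word_eval (S : nzRingType) (x y : S) (m : {fmonom bool}) : S :=
  \prod_(b <- m : seq bool) (if b then y else x).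

(** Words are evaluated multiplicatively and scalars go to the centre of the
    algebra [S], so the linear extension of [word_eval] is multiplicative. *)
Lemma free_alg2_eval (A : comNzRingType) (S : algType A) (x y : S) :
  exists phi : {rmorphism free_alg2 A -> S},
    phi (genx A) = x /\ phi (geny A) = y.
Proof.
pose h := word_eval _ x y.
have hM : mmorphism h.
  by split=> [m1 m2|]; rewrite /h /word_eval ?fmM ?big_cat // fm1 big_nil.
pose hI := isMultiplicative.Build _ _ h hM.
pose H : {mmorphism {fmonom bool} -> S} := HB.pack h hI.
pose phi : free_alg2 A -> S := mmap (GRing.in_alg S) H.
have phiM : monoid_morphism phi.
  case: (@commr_mmap_is_multiplicative _ _ _ (GRing.in_alg S) H) => //.
  by move=> g m m'; rewrite /GRing.comm -scalerAl -scalerAr mul1r mulr1.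
have phiB : zmod_morphism phi by exact: raddfB.
pose phiZ := GRing.isZmodMorphism.Build _ _ phi phiB.
pose phiR := GRing.isMonoidMorphism.Build _ _ phi phiM.
pose P : {rmorphism free_alg2 A -> S} := HB.pack phi phiZ phiR.
exists P; split; rewrite [LHS]mmapU /= scale1r mul1r /h /word_eval fmU;
by rewrite big_seq1.
Qed.

(** A ring morphism out of [R11] into matrices is never zero, since it sends
    [1] to [1]; so its existence is that of the images of the two generators. *)
Lemma in_calA11P (k : fieldType) (i j : nat) :
  in_calA11 k i j <->
  exists x y : 'M[k]_2, x ^+ i * y + y * x ^+ j = 1 /\ y ^+ 2 = 0.
Proof.
split=> [[f _] | [x [y [xy1 yy0]]]].
  pose p (a : free_alg2 k) : R11 k i j := \pi a.
  have pM : {morph p : a b / a * b} by exact: pi_ring_quotM.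
  have pD : {morph p : a b / a + b} by exact: pi_ring_quotD.
  have p0 : p 0 = 0 by apply: (addrI (p 0)); rewrite -pD !addr0.
  have pX a n : p (a ^+ n) = p a ^+ n.
    by elim: n => // n IHn; rewrite !exprS pM IHn.
  have pE a b : in_ideal (@rels k i j) (a - b) -> p a = p b.
    by move=> Iab; apply/(pi_ring_quotE (@rels k i j)).
  exists (f (p (genx k))), (f (p (geny k))).
  rewrite -!rmorphXn -!rmorphM -rmorphD -!pX -!pM -pD; split.
    rewrite -[1 in RHS](rmorph1 f); congr (f _).
    by apply: (pE _ 1); apply: in_ideal_gen; left.
  rewrite -[0 in RHS](rmorph0 f); congr (f _).
  by rewrite -p0; apply: pE; rewrite subr0; apply: in_ideal_gen; right.
have [phi [phix phiy]] := free_alg2_eval k _ x y.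
have [|f _] := ring_quot_lift _ (@rels k i j) _ phi.
  move=> a [] ->; rewrite ?rmorphB ?rmorphD ?rmorphM ?rmorphXn ?rmorph1 /=.
    by rewrite phix phiy xy1 subrr.
  by rewrite phiy.
by exists f, 1; rewrite rmorph1 oner_neq0.
Qed.

End UniversalProperty.

Section Commutation.
Local Open Scope ring_scope.
Variables (R : nzRingType) (R2 : 2%N \in [pchar R]).
Implicit Types a b x y z : R.

(** If [a] commutes with [y], then
    [y = y * (a * y + y * b) = a * y * y + y * y * b = 0], and symmetrically
    for [b].  This excludes [a = 0] and [a = 1] at once. *)
Lemma square0_not_comm a b y :
  y ^+ 2 = 0 -> a * y + y * b = 1 -> ~ GRing.comm a y /\ ~ GRing.comm b y.
Proof.
rewrite expr2 => yy0 ayb1.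
have y_neq0 : y <> 0.
  by move=> y0; move/eqP: ayb1; rewrite y0 mulr0 mul0r addr0 eq_sym oner_eq0.
split=> ay; apply: y_neq0.
  by rewrite -[y]mulr1 -ayb1 mulrDr !mulrA -ay -mulrA yy0 mulr0 mul0r addr0.
by rewrite -[y]mul1r -ayb1 mulrDl -!mulrA ay !mulrA -mulrA yy0 mulr0 mul0r addr0.
Qed.

(** In characteristic two the hypothesis says that the commutator of [x] and
    [y] is [1], whence that of [x ^+ 2] and [y] is [2 * x = 0]. *)
Lemma anticomm_sqr x y : x * y + y * x = 1 -> x ^+ 2 * y + y * x ^+ 2 = 0.
Proof.
move=> xy1; have xy : x * y = 1 + y * x.
  by rewrite -xy1 -addrA addrr_pchar2 // addr0.
rewrite expr2 -mulrA xy mulrDr mulr1 mulrA xy mulrDl mul1r addrA.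
by rewrite addrr_pchar2 // add0r -mulrA addrr_pchar2.
Qed.

(** [x] and [x + c%:R] have the same commutator with [y], and that of
    [x ^+ 2] vanishes. *)
Lemma anticomm_sqr_neq x y (c : bool) :
  x ^+ 2 = x + c%:R -> x * y + y * x = 1 -> False.
Proof.
move=> xx xy1; have /eqP := anticomm_sqr _ _ xy1.
rewrite xx mulrDl mulrDr addrACA xy1 mulr_natr mulr_natl addrr_pchar2 //.
by rewrite addr0 oner_eq0.
Qed.

(** The condition on [x ^+ 2] is all that the argument needs to know about
    matrices; [sqr_mx2_F2] supplies it. *)
Lemma exponents_of_solution x y i j :
    [\/ x ^+ 2 = 0, x ^+ 2 = 1, x ^+ 2 = x | x ^+ 2 = x + 1] ->
    (0 < i)%N -> (0 < j)%N -> y ^+ 2 = 0 -> x ^+ i * y + y * x ^+ j = 1 ->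
  admissible i j.
Proof.
move=> x2 i_gt0 j_gt0 yy0 xy1; have [ncx ncy] := square0_not_comm _ _ _ yy0 xy1.
have neq0 n : x ^+ 2 = 0 -> ~ GRing.comm (x ^+ n) y -> (0 < n)%N -> n = 1%N.
  case: n => [|[|n]] // xx ncn _; case: ncn.
  by rewrite -addn2 exprD xx mulr0; apply/commr_sym/commr0.
have neq1 d n : x ^+ d = 1 -> ~ GRing.comm (x ^+ n) y -> (n %% d != 0)%N.
  move=> xd ncn; apply/eqP => n0; case: ncn.
  by rewrite -(expr_mod _ xd) n0; apply/commr_sym/commr1.
case: x2 => x2.
- by constructor 1; move: (neq0 i x2 ncx i_gt0) (neq0 j x2 ncy j_gt0) => -> ->.
- constructor 1; move: (neq1 2 i x2 ncx) (neq1 2 j x2 ncy).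
  by rewrite !modn2 !eqb0 !negbK => -> ->.
- have xn n : (0 < n)%N -> x ^+ n = x.
    by case: n => // n _; elim: n => // n IHn; rewrite exprS IHn -expr2.
  case: (anticomm_sqr_neq x y false); rewrite ?addr0 //.
  by rewrite !xn in xy1.
have x3 : x ^+ 3 = 1.
  by rewrite exprS x2 mulrDr mulr1 -expr2 x2 addrAC addrr_pchar2 ?add0r.
rewrite /admissible; move: xy1 (neq1 3 i x3 ncx) (neq1 3 j x3 ncy).
rewrite -(expr_mod i x3) -(expr_mod j x3).
move: (ltn_pmod i (isT : 0 < 3)%N) (ltn_pmod j (isT : 0 < 3)%N).
case: (i %% 3)%N (j %% 3)%N => [|[|[|?]]] // [|[|[|?]]] // _ _ xy1 _ _.
- by case: (anticomm_sqr_neq x y true).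
- by constructor 2.
- by constructor 3.
(* Both exponents are 2 mod 3: replacing [x ^+ 2] by [x + 1] adds [2 * y = 0]
   to [x * y + y * x]. *)
case: (anticomm_sqr_neq x y true) => //; move: xy1.
by rewrite x2 mulrDl mulrDr mul1r mulr1 addrACA addrr_pchar2 ?addr0.
Qed.

(** The hypotheses say that [y], [z], [y * z] and [z * y] are the four matrix
    units of a two by two matrix algebra, so [w] below is the swap and [x] is
    the matrix with a zero only in the corner of [y * z], whose order is
    three. *)
Lemma solution_of_exponents y z i j :
    y ^+ 2 = 0 -> z ^+ 2 = 0 -> y * z + z * y = 1 ->
    admissible i j ->
  exists x, x ^+ i * y + y * x ^+ j = 1.
Proof.
rewrite !expr2 => yy0 zz0 yz1; pose w := y + z; pose x := w + z * y.
have wy : w * y = z * y by rewrite mulrDl yy0 add0r.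
have yw : y * w = y * z by rewrite mulrDr yy0 add0r.
have wz : w * z = y * z by rewrite mulrDl zz0 addr0.
have yzy : y * z * y = y.
  by rewrite -[RHS]mul1r -yz1 mulrDl -(mulrA z) yy0 mulr0 addr0.
have zyz : z * y * z = z.
  by rewrite -[RHS]mul1r -yz1 mulrDl -(mulrA y) zz0 mulr0 add0r.
have w2 : w ^+ 2 = 1 by rewrite expr2 {2}/w mulrDr wy mulrDl zz0 addr0 addrC.
have x2 : x ^+ 2 = x + 1.
  rewrite expr2 /x mulrDl !(mulrDr _ w) -(expr2 w) w2 (mulrA w) wz.
  rewrite yzy -!mulrA yw (mulrA y z y) yzy (mulrA z) zyz.
  by rewrite -addrA [y + (_ + _)]addrA addrC.
have x3 : x ^+ 3 = 1.
  by rewrite exprS x2 mulrDr mulr1 -expr2 x2 addrAC addrr_pchar2 ?add0r.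
have xy : x * y = z * y by rewrite mulrDl wy -mulrA yy0 mulr0 addr0.
have yx : y * x = y * z + y by rewrite mulrDr yw mulrA yzy.
case=> [[i1 j1] | [i1 j2] | [i2 j1]].
- exists w; rewrite -(expr_mod i w2) -(expr_mod j w2) i1 j1.
  by rewrite wy yw addrC.
- exists x; rewrite -(expr_mod i x3) -(expr_mod j x3) i1 j2.
  rewrite [(2 %% 3)%N]/= x2 mulrDr mulr1 xy yx -(addrA _ y) addrr_pchar2 //.
  by rewrite addr0 addrC.
exists x; rewrite -(expr_mod i x3) -(expr_mod j x3) i2 j1.
rewrite [(2 %% 3)%N]/= x2 mulrDl mul1r xy yx (addrC (y * z)) addrA.
by rewrite -(addrA _ y y) addrr_pchar2 // addr0 addrC.
Qed.

End Commutation.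

Section TwoByTwo.
Local Open Scope ring_scope.

Lemma sqr_mx2_linear (A : comNzRingType) (x : 'M[A]_2) :
  exists a b : A, x ^+ 2 = a *: x + b%:M.
Proof.
have := Cayley_Hamilton x; have := size_char_poly x; have := char_poly_monic x.
rewrite monicE /lead_coef => /[swap] sz; rewrite sz /=.
move: (char_poly x) sz => p sz /eqP p2.
have -> : p = 'X^2 + (p`_1 *: 'X + (p`_0)%:P).
  apply/polyP=> n; rewrite !coefE.
  case: n => [|[|[|n]]]; rewrite ?p2 /= ?(mulr0, mulr1, addr0, add0r) //.
  by rewrite nth_default ?sz.
rewrite !rmorphD /= linearZ /= rmorphXn /= horner_mx_X horner_mx_C.
move/eqP; rewrite addr_eq0 opprD -scaleNr -raddfN => /eqP ->.
by exists (- p`_1), (- p`_0).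
Qed.

Lemma sqr_mx2_F2 (x : 'M['F_2]_2) :
  [\/ x ^+ 2 = 0, x ^+ 2 = 1, x ^+ 2 = x | x ^+ 2 = x + 1].
Proof.
have F2 (a : 'F_2) : a = 0 \/ a = 1.
  by case: a => [[|[|//]] ?]; [left | right]; apply: val_inj.
have [a [b ->]] := sqr_mx2_linear _ x.
case: (F2 a) (F2 b) => -> [] ->; rewrite ?scale0r ?scale1r ?raddf0 ?addr0 ?add0r.
- by constructor 1.
- by constructor 2.
- by constructor 3.
by constructor 4.
Qed.

Lemma delta_mx_anticomm (A : nzRingType) :
  delta_mx 0 1 * delta_mx 1 0 + delta_mx 1 0 * delta_mx 0 1 = 1 :> 'M[A]_2.
Proof.
rewrite [X in X + _]mul_delta_mx [X in _ + X]mul_delta_mx.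
by apply/matrixP=> -[[|[|//]] ?] -[[|[|//]] ?]; rewrite !mxE ?(addr0, add0r).
Qed.

End TwoByTwo.

Theorem theorem3p6 (i j : nat) (hi : (0 < i)%N) (hj : (0 < j)%N) :
  in_calA11 'F_2 i j <->
  [\/ i = 1 %[mod 2] /\ j = 1 %[mod 2],
      i = 1 %[mod 3] /\ j = 2 %[mod 3] |
      i = 2 %[mod 3] /\ j = 1 %[mod 3]].
Proof.
have M2 : (2%N \in [pchar 'M['F_2]_2])%R by rewrite pchar_lalg pchar_Fp.
have E2 (a b : 'I_2) : a != b -> (delta_mx a b ^+ 2 = 0 :> 'M['F_2]_2)%R.
  by move=> ab; rewrite expr2 [LHS]mul_delta_mx_0 // eq_sym.
apply: (iff_trans (in_calA11P _ _ _)); split=> [[x [y [xy1 yy0]]] | ij].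
  exact: exponents_of_solution M2 x y i j (sqr_mx2_F2 x) hi hj yy0 xy1.
have [x xy1] := solution_of_exponents _ M2 _ _ i j
  (E2 0 1 isT)%R (E2 1 0 isT)%R (delta_mx_anticomm _) ij.
by exists x, (delta_mx 0 1)%R; split=> //; exact: E2.
Qed.
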